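(* Let $V\subset\mathbb{R}^d$ be a finite or countable set of isolated points, let $I(V)=\{p\in\Pi^d: p(x)=0 \text{ for all } x\in V\}$, fix a monomial order on $\Pi^d=\mathbb{R}[x_1,\dots,x_d]$, and let $\Lambda=\Lambda(V)=\{\alpha\in\mathbb{N}_0^d : x^\alpha\notin \mathrm{LT}(I(V))\}$. Then every $P\in\mathbb{R}[V]$ can be written uniquely as $$P(x)=\sum_{\alpha\in\Lambda}c_\alpha x^\alpha \mod I(V),\qquad c_\alpha\in\mathbb{R}$$ (a finite sum), and the set $\Lambda$ satisfies the following property: if $\alpha\in\Lambda$, then $\alpha-\beta\in\Lambda$ whenever $\beta\in\mathbb{N}_0^d$ and $\alpha-\beta\in\mathbb{N}_0^d$.
   Context: $\Pi^d=\mathbb{R}[x_1,\dots,x_d]$, and $x^\alpha=x_1^{\alpha_1}\cdots x_d^{\alpha_d}$ for $\alpha\in\mathbb{N}_0^d$. For $f,g\in\Pi^d$, $f=g \mod I$ means $f-g\in I$. $\mathbb{R}[V]$ is the ring of polynomial functions $V\to\mathbb{R}$ (restrictions of polynomials to $V$), identified with $\Pi^d/I(V)$. For a nonzero polynomial $f$, $\mathrm{LT}(f)$ is its leading term $c_\beta x^\beta$ with respect to the fixed monomial order. For an ideal $I$, $\mathrm{LT}(I)=\{c x^\alpha : \text{there exists } f\in I \text{ with } \mathrm{LT}(f)=c x^\alpha\}$, and $\langle\mathrm{LT}(I)\rangle$ is the ideal it generates; a monomial lies in $\mathrm{LT}(I)$ if and only if it lies in $\langle\mathrm{LT}(I)\rangle$.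 *)

(* Defs.v *)
From HB Require Import structures.
From mathcomp Require Import all_boot all_order all_algebra.
From mathcomp Require Import mpoly.
From mathcomp Require Import boolp classical_sets functions cardinality fsbigop.
From mathcomp Require Import reals topology.

Set Implicit Arguments.
Unset Strict Implicit.
Unset Printing Implicit Defensive.

Import GRing.Theory.

Local Open Scope classical_set_scope.
Local Open Scope ring_scope.

Record monomial_order (d : nat) (le : rel 'X_{1..d}) : Prop := MonomialOrder {
  monomial_order_anti : antisymmetric le;
  monomial_order_trans : transitive le;
  monomial_order_total : total le;
  monomial_order_add : forall a b c : 'X_{1..d},
    le a b -> le (a + c)%MM (b + c)%MM;
  monomial_order_wf : forall A : set 'X_{1..d},
    A !=set0 -> exists2 a, A a & forall b, A b -> le a b }.

Section LeadingTerms.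
Variables (R : realType) (d : nat) (le : rel 'X_{1..d}).

(* [msupp f] lists the monomials occurring in [f]; after sorting by [le] the
   last one is the largest.  Meaningful for [f != 0] only. *)
Definition lead_exp (f : {mpoly R[d]}) : 'X_{1..d} :=
  last 0%MM (sort le (msupp f)).

Definition lead_term (f : {mpoly R[d]}) : {mpoly R[d]} :=
  f@_(lead_exp f) *: 'X_[lead_exp f].

Definition lead_terms (I : set {mpoly R[d]}) : set {mpoly R[d]} :=
  [set t | exists f, [/\ I f, f != 0 & lead_term f = t]].

End LeadingTerms.

Section Varieties.
Variables (R : realType) (d : nat) (V : set 'rV[R]_d).

Definition evalp (p : {mpoly R[d]}) (x : 'rV[R]_d) : R := p.@[fun i => x 0 i].

Definition vanishing_ideal : set {mpoly R[d]} :=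
  [set p | forall x, V x -> evalp p x = 0].

Definition restrict_poly (p : {mpoly R[d]}) : V -> R :=
  fun x => evalp p (set_val x).

(* The identification of R[V] with the quotient by the vanishing ideal of [V]
   sends a function [P] to the class [[set p | restrict_poly p = P]]. *)
Definition polynomial_functions : set (V -> R) := range restrict_poly.

Definition standard_exponents (le : rel 'X_{1..d}) : set 'X_{1..d} :=
  [set a | ~ lead_terms le vanishing_ideal 'X_[a]].

End Varieties.

Definition eq_mod (R : realType) (d : nat) (I : set {mpoly R[d]})
  (f g : {mpoly R[d]}) : Prop := I (f - g).

(* Main.v *)
Require Import Defs.
From HB Require Import structures.
From mathcomp Require Import all_boot all_order all_algebra.
From mathcomp Require Import mpoly.
From mathcomp Require Import boolp classical_sets functions cardinality fsbigop.
From mathcomp Require Import reals topology.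

Set Implicit Arguments.
Unset Strict Implicit.
Unset Printing Implicit Defensive.

Import GRing.Theory numFieldTopology.Exports.

Local Open Scope classical_set_scope.
Local Open Scope ring_scope.


(** The argument is the division algorithm for an arbitrary ideal [I] of the
    polynomial ring, applied to [I = vanishing_ideal V].  Two polynomials have
    the same restriction to [V] exactly when they are congruent modulo this ideal,
    so a polynomial function is a congruence class.

    Call an exponent standard when its monomial is not the leading term of an
    element of [I].  Since the coefficients form a field, [a] is nonstandard as
    soon as some nonzero [f] in [I] has leading exponent [a]
    ([lead_termsXP]).

    Existence ([normal_form_exists]): if the leading monomial of [p] is standard,
    set it aside; otherwise subtract the multiple of an element of [I] that
    cancels it.  Either way the leading exponent drops, and the monomial order is
    a well-order, so the process ends with a normal form of [p], a representative
    modulo [I] all of whose monomials are standard.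

    Uniqueness ([normal_form_eq0]): the difference of two normal forms
    lies in [I] and has only standard monomials; were it nonzero, its leading
    exponent would be both standard and nonstandard.

    Staircase ([standard_subm]): multiplying [f] in [I] by a monomial
    translates its leading exponent, so nonstandard exponents are stable under
    addition. *)

(** * Leading exponents *)

Section LeadingExponent.
Variables (R : realType) (d : nat) (le : rel 'X_{1..d}).
Hypothesis le_order : monomial_order le.
Implicit Types (f : {mpoly R[d]}) (a b m : 'X_{1..d}).

Lemma lead_exp_in_msupp f : f != 0 -> lead_exp le f \in msupp f.
Proof.
rewrite -msupp_eq0 /lead_exp -(mem_sort le) -size_eq0 -(size_sort le) size_eq0.
by case: (sort le (msupp f)) => //= m s _; rewrite mem_last.
Qed.

Lemma lead_exp_max f m : m \in msupp f -> le m (lead_exp le f).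
Proof.
have total_le := monomial_order_total le_order.
have := sort_sorted total_le (msupp f).
rewrite /lead_exp -(mem_sort le) sorted_pairwise; last first.
  exact: monomial_order_trans le_order.
case/lastP: (sort le (msupp f)) => // s x.
rewrite pairwise_rcons last_rcons mem_rcons inE => /andP[/allP s_le_x _].
by case/predU1P => [->|/s_le_x//]; have := total_le x x; rewrite orbb.
Qed.

Lemma lead_exp_eq f m :
  m \in msupp f -> (forall b, b \in msupp f -> le b m) -> lead_exp le f = m.
Proof.
move=> m_f max_m; apply: (monomial_order_anti le_order).
rewrite lead_exp_max // max_m // lead_exp_in_msupp //.
by rewrite -msupp_eq0; case: (msupp f) m_f.
Qed.

Lemma lead_exp_mulX f b : f != 0 ->
  lead_exp le (f * 'X_[b]) = (b + lead_exp le f)%MM.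
Proof.
move=> f_neq0; apply: lead_exp_eq => [|m].
  by rewrite (perm_mem (msuppMX f b)) map_f // lead_exp_in_msupp.
rewrite (perm_mem (msuppMX f b)) => /mapP[c c_f ->].
rewrite ![(b + _)%MM]addmC; apply: (monomial_order_add le_order).
exact: lead_exp_max.
Qed.

End LeadingExponent.

(** * Normal forms modulo an ideal *)

Section NormalForm.
Variables (R : realType) (d : nat) (le : rel 'X_{1..d}).
Hypothesis le_order : monomial_order le.
Variable I : set {mpoly R[d]}.
Hypothesis I0 : I 0.
Hypothesis ID : forall f g, I f -> I g -> I (f + g).
Hypothesis IM : forall h f, I f -> I (h * f).
Implicit Types (f p q r : {mpoly R[d]}) (a b m : 'X_{1..d}).

Let standard : set 'X_{1..d} := [set a | ~ lead_terms le I 'X_[a]].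

Let IZ (k : R) f : I f -> I (k *: f).
Proof. by move=> If; rewrite -mul_mpolyC; apply: IM. Qed.

(** Dividing by the leading coefficient, a unit, turns any leading term into a
    bare monomial. *)
Lemma lead_termsXP a :
  lead_terms le I 'X_[a] <-> exists f, [/\ I f, f != 0 & lead_exp le f = a].
Proof.
split=> -[f [If f_neq0 lead_f]].
  exists f; split=> //.
  (* Equal terms have equal exponents because the leading coefficient is
     nonzero: compare coefficients at [lead_exp le f]. *)
  have := lead_exp_in_msupp le f_neq0.
  rewrite mcoeff_msupp => lc_neq0; apply/eqP.
  move/(congr1 (mcoeff (lead_exp le f))): lead_f.
  rewrite /lead_term mcoeffZ !mcoeffX eqxx mulr1.
  by case: eqVneq => // _ /eqP; rewrite (negPf lc_neq0).
have a_f : a \in msupp f by rewrite -lead_f lead_exp_in_msupp.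
have fa_neq0 : f@_a != 0 by rewrite -mcoeff_msupp.
have lead_fa : lead_exp le ((f@_a)^-1 *: f) = a.
  apply: lead_exp_eq => // [|b].
    by rewrite mcoeff_msupp mcoeffZ mulVf // oner_neq0.
  rewrite mcoeff_msupp mcoeffZ mulf_eq0 negb_or -mcoeff_msupp => /andP[_ b_f].
  by rewrite -lead_f; apply: lead_exp_max.
exists ((f@_a)^-1 *: f); split; first exact: IZ.
  by rewrite scaler_eq0 negb_or invr_neq0.
by rewrite /lead_term lead_fa mcoeffZ mulVf // scale1r.
Qed.

Lemma standard_subm a b : standard a -> (b <= a)%MM -> standard (a - b)%MM.
Proof.
move=> std_a le_ba /lead_termsXP[f [If f_neq0 lead_f]]; apply/std_a/lead_termsXP.
exists (f * 'X_[b]); split; first by rewrite mulrC; apply: IM.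
  by rewrite mulf_neq0 // -msupp_eq0 msuppX.
by rewrite lead_exp_mulX // lead_f addmC submK.
Qed.

Lemma normal_form_eq0 r : I r -> (forall m, m \in msupp r -> standard m) -> r = 0.
Proof.
move=> Ir std_r; apply/eqP/negPn/negP => r_neq0.
apply: (std_r _ (lead_exp_in_msupp le r_neq0)).
by apply/lead_termsXP; exists r.
Qed.

(** Minimal-counterexample form of the division algorithm: take [q] without a
    normal form and with least possible leading exponent [m].  Subtracting a
    multiple of [f] in [I] with leading exponent [m], or of the monomial [m]
    itself when it is standard, kills the coefficient at [m] and introduces no
    exponent above [m]; by minimality the difference has a normal form, and
    so does [q]. *)
Lemma normal_form_exists p :
  exists2 r, I (p - r) & forall m, m \in msupp r -> standard m.
Proof.
pose reducible p := exists2 r, I (p - r) & forall m, m \in msupp r -> standard m.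
have reducible0 : reducible 0.
  by exists 0; rewrite ?subr0 // => m; rewrite msupp0.
have [//|irr_p] := pselect (reducible p).
pose A := [set m | exists2 q, ~ reducible q & lead_exp le q = m].
have [m [q irr_q lead_q] min_m] : exists2 m, A m & forall b, A b -> le m b.
  by apply: (monomial_order_wf le_order); exists (lead_exp le p), p.
have q_neq0 : q != 0 by apply: contra_notN irr_q => /eqP ->.
have m_q : m \in msupp q by rewrite -lead_q lead_exp_in_msupp.
have lower_reducible (q' : {mpoly R[d]}) :
    q'@_m = 0 -> (forall b, b \in msupp q' -> le b m) -> reducible q'.
  move=> q'm le_q'm; apply: contrapT => irr_q'.
  have q'_neq0 : q' != 0 by apply: contra_notN irr_q' => /eqP ->.
  have lead_q' := lead_exp_in_msupp le q'_neq0.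
  have lead_q'E : lead_exp le q' = m.
    apply: (monomial_order_anti le_order).
    by rewrite le_q'm //= min_m //; exists q'.
  by move: lead_q'; rewrite lead_q'E mcoeff_msupp q'm eqxx.
have le_cancel (f : {mpoly R[d]}) (k : R) :
    (forall b, b \in msupp f -> le b m) ->
    forall b, b \in msupp (q - k *: f) -> le b m.
  move=> le_fm b /msuppB_le; rewrite mem_cat => /orP[b_q|/msuppZ_le/le_fm//].
  by rewrite -lead_q; apply: lead_exp_max.
have [/lead_termsXP[f [If f_neq0 lead_f]]|std_m] :=
  pselect (lead_terms le I 'X_[m]).
  have m_f : f@_m != 0 by rewrite -mcoeff_msupp -lead_f lead_exp_in_msupp.
  case: irr_q; pose k := q@_m / f@_m.
  have [||r Ir std_r] := lower_reducible (q - k *: f).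
  - by rewrite mcoeffB mcoeffZ divfK // subrr.
  - by apply: le_cancel => b b_f; rewrite -lead_f; apply: lead_exp_max.
  exists r => //; have -> : q - r = (q - k *: f - r) + k *: f.
    by rewrite addrAC subrK.
  by apply: ID => //; apply: IZ.
case: irr_q; have [||r Ir std_r] := lower_reducible (q - q@_m *: 'X_[m]).
- by rewrite mcoeffB mcoeffZ mcoeffX eqxx mulr1 subrr.
- apply: le_cancel => b; rewrite msuppX inE => /eqP ->.
  by rewrite -{2}lead_q; apply: lead_exp_max.
exists (r + q@_m *: 'X_[m]); first by rewrite opprD [- r - _]addrC addrA.
move=> b /msuppD_le; rewrite mem_cat => /orP[/std_r//|/msuppZ_le].
by rewrite msuppX inE => /eqP ->.
Qed.

End NormalForm.

(** * Polynomials with prescribed exponents *)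

Section ExponentSum.
Variables (R : realType) (d : nat) (S : set 'X_{1..d}).
Implicit Types (c : S -> R) (r : {mpoly R[d]}).

Let exponent_sum c : {mpoly R[d]} := \sum_(a \in [set: S]) c a *: 'X_[set_val a].

(** Membership in [S] is only classically decidable, and [insub] performs the case
    distinction.  The sum is over a possibly infinite type and is zero by
    convention when the support is infinite, hence the finiteness assumption. *)
Lemma mcoeff_exponent_sum c m : finite_set [set a | c a != 0] ->
  (exponent_sum c)@_m = if insub m is Some a then c a else 0.
Proof.
move=> fin_c; rewrite /exponent_sum.
rewrite (fsbigTE (fset_set [set a | c a != 0])); last first.
  move=> a; rewrite in_fset_set // notin_setE /= => /negP; rewrite negbK.
  by move=> /eqP ->; rewrite scale0r.
rewrite raddf_sum /=; case: insubP => [a _ <-|m_notin].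
  have [ca0|ca_neq0] := eqVneq (c a) 0; last first.
    rewrite (bigD1_seq a) /= ?finmap.fset_uniq //; last first.
      by rewrite in_fset_set // inE.
    rewrite mcoeffZ mcoeffX eqxx mulr1 big1 ?addr0 // => b b_neq_a.
    by rewrite mcoeffZ mcoeffX (inj_eq val_inj) (negPf b_neq_a) mulr0.
  rewrite ca0; apply: big1 => b _; rewrite mcoeffZ mcoeffX (inj_eq val_inj).
  by case: eqVneq => [->|_]; rewrite ?ca0 ?mul0r ?mulr0.
apply: big1 => b _; rewrite mcoeffZ mcoeffX; case: eqVneq => [bm|_].
  by rewrite -bm (valP b) in m_notin.
by rewrite mulr0.
Qed.

Lemma msupp_exponent_sum c m : finite_set [set a | c a != 0] ->
  m \in msupp (exponent_sum c) -> S m.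
Proof.
move=> fin_c; rewrite mcoeff_msupp mcoeff_exponent_sum //.
by case: insubP => [a m_S _ _|]; [exact: set_mem | rewrite eqxx].
Qed.

Lemma exponent_sum_inj c c' :
  finite_set [set a | c a != 0] -> finite_set [set a | c' a != 0] ->
  exponent_sum c = exponent_sum c' -> c = c'.
Proof.
move=> fin_c fin_c' eq_cc'; apply/funext => a.
have := congr1 (mcoeff (val a)) eq_cc'.
by rewrite !mcoeff_exponent_sum // valK.
Qed.

Lemma finite_coefficients r : finite_set [set a : S | r@_(set_val a) != 0].
Proof.
apply: (@sub_finite_set _ _ (set_val @^-1` [set` msupp r])).
  by move=> a /=; rewrite mcoeff_msupp.
by apply: finite_preimage; [move=> ? ? _ _; apply: val_inj | exact: finite_seq].
Qed.

Lemma exponent_sum_mcoeff r : (forall m, m \in msupp r -> S m) ->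
  exponent_sum (fun a => r@_(set_val a)) = r.
Proof.
move=> std_r; apply/mpolyP => m; rewrite mcoeff_exponent_sum; last first.
  exact: finite_coefficients.
case: insubP => [a _ <- //|m_notin]; apply/esym/eqP; rewrite mcoeff_eq0.
by apply: contra m_notin => /std_r; apply: mem_set.
Qed.

End ExponentSum.

(** * Standard monomials of a point set *)

Theorem proposition2p2 (R : realType) (d : nat) (V : set 'rV[R]_d)
    (le : rel 'X_{1..d}) :
  countable V -> V `<=` isolated V -> monomial_order le ->
  (forall P : V -> R, polynomial_functions P ->
    exists! c : standard_exponents V le -> R,
      finite_set [set a | c a != 0] /\
      forall p : {mpoly R[d]}, restrict_poly p = P ->
        eq_mod (vanishing_ideal V) p
          (\sum_(a \in [set: standard_exponents V le]) c a *: 'X_[set_val a])) /\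
  (forall a b : 'X_{1..d}, standard_exponents V le a ->
    (b <= a)%MM -> standard_exponents V le (a - b)%MM).
Proof.
move=> _ _ le_order.
set I := vanishing_ideal V.
have I0 : I 0 by move=> x _; rewrite /evalp meval0.
have ID f g : I f -> I g -> I (f + g).
  move=> If Ig x Vx; rewrite /evalp mevalD [X in X + _]If // [X in _ + X]Ig //.
  exact: addr0.
have IM h f : I f -> I (h * f).
  by move=> If x Vx; rewrite /evalp mevalM [X in _ * X]If // mulr0.
have IB f g : I f -> I g -> I (f - g).
  by move=> If Ig; rewrite -mulN1r; apply/ID => //; apply: IM.
split; last by move=> a b; apply: standard_subm.
move=> P [p0 _ p0P].
have [r Ir std_r] := normal_form_exists le_order I0 ID IM p0.
exists (fun a => r@_(set_val a)); split.
  split=> [|p pP]; first exact: finite_coefficients.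
  rewrite exponent_sum_mcoeff // /eq_mod -/I -(subrK p0 p) -addrA.
  apply: ID => // x Vx; rewrite /evalp mevalB.
  pose y : V := SigSub (mem_set Vx).
  have := congr1 (@^~ y) (etrans pP (esym p0P)).
  by rewrite /restrict_poly /evalp /= => ->; rewrite subrr.
move=> c [fin_c /(_ p0 p0P) Ic].
apply: exponent_sum_inj => //; first exact: finite_coefficients.
rewrite exponent_sum_mcoeff //; apply/eqP; rewrite -subr_eq0; apply/eqP.
apply: (normal_form_eq0 le_order IM).
  by have := IB _ _ Ic Ir; rewrite opprB addrC addrA subrK.
move=> m /msuppB_le; rewrite mem_cat => /orP[/std_r//|].
exact: msupp_exponent_sum.
Qed.
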